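(* The class of languages recognizable by a QFA is not closed under union: there are a finite alphabet $\Sigma$ and languages $L,L'\subseteq\Sigma^*$, each recognizable by a QFA, such that $L\cup L'$ is not recognizable by a QFA.
   Context: A 1-way quantum finite automaton (QFA) is a tuple $(Q,\Sigma,V,q_0,Q_{acc},Q_{rej})$: $Q$ is a finite set of states, $\Sigma$ a finite input alphabet, $q_0\in Q$ the starting state, $Q_{acc},Q_{rej}\subseteq Q$ are disjoint sets of accepting and rejecting states, and $Q_{non}=Q\setminus(Q_{acc}\cup Q_{rej})$. Let $l_2(Q)$ be the complex Hilbert space with orthonormal basis $\{|q\rangle: q\in Q\}$, and $E_{acc},E_{rej},E_{non}$ the spans of $\{|q\rangle\}$ for $q$ in $Q_{acc},Q_{rej},Q_{non}$ respectively. With endmarkers $\kappa,\$\notin\Sigma$ and $\Gamma=\Sigma\cup\{\kappa,\$\}$, $V$ assigns to each $a\in\Gamma$ a unitary map $V_a$ on $l_2(Q)$. On input $w\in\Sigma^*$ the automaton starts in $|q_0\rangle$ and reads the letters of $\kappa w\$$ in order. Reading $a$ in the current (unnormalized) superposition $\psi$ means: compute $V_a\psi$; the automaton accepts (and halts) with probability the squared norm of the projection of $V_a\psi$ onto $E_{acc}$, rejects (and halts) with probability the squared norm of its projection onto $E_{rej}$, and otherwise continues with the unnormalized superposition equal to the projection of $V_a\psi$ onto $E_{non}$. The probability of accepting (rejecting) $w$ is the sum of these acceptance (rejection) probabilities over all letters of $\kappa w\$$. A QFA recognizes $L$ with probability $p>\frac12$ if it accepts every $w\in L$ with probability $\geq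 p$ and rejects every $w\in\Sigma^*\setminus L$ with probability $\geq p$. $L$ is recognizable by a QFA if this holds for some QFA and some $p>\frac12$. *)

(* Defs.v *)
From HB Require Import structures.
From mathcomp Require Import all_boot all_order all_algebra.
From mathcomp Require Import complex.
From mathcomp Require Import classical_sets reals.

Set Implicit Arguments.
Unset Strict Implicit.
Unset Printing Implicit Defensive.

Import GRing.Theory Num.Theory.

Local Open Scope ring_scope.

(* The alphabet extended with the two endmarkers, which are thereby not in
   [Sigma]. *)
Inductive letter (Sigma : Type) : Type :=
  | LeftEnd
  | Sym of Sigma
  | RightEnd.

Arguments LeftEnd {Sigma}.
Arguments RightEnd {Sigma}.

Section L2.
Variables (R : realType) (Q : finType).

(* The coordinate of a vector along |q> is the one at index [enum_rank q]. *)
Definition l2 := 'cV[R[i]]_#|Q|.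

Definition ket (q : Q) : l2 := delta_mx (enum_rank q) 0.

Definition proj (S : {set Q}) (psi : l2) : l2 :=
  \col_i (if enum_val i \in S then psi i 0 else 0).

(* [normc] is the modulus as an element of [R]; the norm [`| _ |] of the
   library takes its values in [R[i]]. *)
Definition sqnorm (psi : l2) : R :=
  \sum_i ComplexField.Normc.normc (psi i 0) ^+ 2.

End L2.

Record qfa (R : realType) (Sigma : finType) := QFA {
  state : finType;
  trans : letter Sigma -> 'M[R[i]]_#|state|;
  start : state;
  acc : {set state};
  rej : {set state};
  trans_unitary : forall a, trans a \is unitarymx;
  acc_rej_disjoint : [disjoint acc & rej]
}.

Section Run.
Variables (R : realType) (Sigma : finType) (A : qfa R Sigma).

Definition non : {set state A} := ~: (acc A :|: rej A).

(* The total probability of halting in [S], which is [acc A] or [rej A], while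
   reading [w] from the unnormalized superposition [psi]. *)
Fixpoint halt_prob (S : {set state A}) (psi : l2 R (state A))
    (w : seq (letter Sigma)) : R :=
  if w is a :: w' then
    let phi : l2 R (state A) := trans A a *m psi in
    sqnorm (proj S phi) + halt_prob S (proj non phi) w'
  else 0.

Definition endmarked (w : seq Sigma) : seq (letter Sigma) :=
  LeftEnd :: rcons (map (@Sym Sigma) w) RightEnd.

Definition accept_prob (w : seq Sigma) : R :=
  halt_prob (acc A) (ket R (start A)) (endmarked w).

Definition reject_prob (w : seq Sigma) : R :=
  halt_prob (rej A) (ket R (start A)) (endmarked w).

Definition recognizes (L : set (seq Sigma)) (p : R) : Prop :=
  (forall w, L w -> p <= accept_prob w) /\
  (forall w, ~ L w -> p <= reject_prob w).

End Run.

Definition qfa_recognizable (R : realType) (Sigma : finType)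
    (L : set (seq Sigma)) : Prop :=
  exists (A : qfa R Sigma) (p : R), 2^-1 < p /\ recognizes A L p.

(* Main.v *)
(** Words over {a, b} are [seq bool], with [a] encoded as [true].  Let [K] be the
    set of words with a [b] and an odd number of [a]s after the first [b].  It is
    the union of its subsets of words with an odd, respectively even, number of
    [a]s before the first [b].

    Each half is recognized with probability 5/9.  The left endmarker creates an
    amplitude 2/3 on each of two independent automata.  The first one tracks the
    parity of all [a]s; the second one tracks the parity of the [a]s up to the
    first [b] and halts there with the right answer for that parity alone.  On
    words of the half both accept (8/9); on any other word at least one rejects,
    and so does the remaining weight 1/9 (4/9 + 1/9).

    For [K], let [M] be the non-halting evolution along a word [u] whose
    Frobenius norm is within [e] of the infimum over all words.  Evolutions
    composed before [M] lose almost no norm, so in finite dimension they are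
    recurrent: [M b (a^2)^n] is close to [M b] for some [n > 0], and similarly
    for powers of [b].  Hence [b u] and [a b^m a^(2n-1) b u] lead to almost the
    same superposition, so appending an [a] changes both acceptance
    probabilities by almost the same amount.  But membership in [K] changes in
    opposite directions. *)

Require Import Defs.
From mathcomp Require Import all_boot all_order all_algebra.
From mathcomp Require Import complex.
From mathcomp Require Import classical_sets reals.
From mathcomp Require Import ring lra zify.

Set Implicit Arguments.
Unset Strict Implicit.
Unset Printing Implicit Defensive.

Import Order.TTheory GRing.Theory Num.Theory.
Import ComplexField.

Local Open Scope ring_scope.
Local Open Scope sesquilinear_scope.

(** * Squared Frobenius norm, unitaries and coordinate projections *)

Section SquaredNorm.
Variable R : realType.

Lemma sqr_normcE (z : R[i]) :
  Normc.normc z ^+ 2 = complex.Re z ^+ 2 + complex.Im z ^+ 2.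
Proof. by case: z => x y /=; rewrite sqr_sqrtr // addr_ge0 ?sqr_ge0. Qed.

Definition frob m n (M : 'M[R[i]]_(m, n)) : R :=
  \sum_i \sum_j Normc.normc (M i j) ^+ 2.

Lemma frob_ge0 m n (M : 'M[R[i]]_(m, n)) : 0 <= frob M.
Proof. by apply: sumr_ge0 => i _; apply: sumr_ge0 => j _; exact: sqr_ge0. Qed.

Lemma frob_trace m n (M : 'M[R[i]]_(m, n)) : (frob M)%:C%C = \tr (M *m M^t*).
Proof.
rewrite /mxtrace rmorph_sum; apply: eq_bigr => i _.
rewrite mxE rmorph_sum; apply: eq_bigr => j _.
by rewrite !mxE -normCK normc_def sqr_normcE -rmorphXn sqr_sqrtr
  ?addr_ge0 ?sqr_ge0.
Qed.

Lemma frob_mul_unitary m n (M : 'M[R[i]]_(m, n)) (U : 'M[R[i]]_n) :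
  U \is unitarymx -> frob (M *m U) = frob M.
Proof.
move=> /unitarymxP UU; apply: complexI.
by rewrite !frob_trace trmx_mul map_mxM mulmxA -(mulmxA M) UU mulmx1.
Qed.

Lemma frob_unitary_mul m n (M : 'M[R[i]]_(m, n)) (U : 'M[R[i]]_m) :
  U \is unitarymx -> frob (U *m M) = frob M.
Proof.
move=> UU; apply: complexI.
have VV : U^t* *m U = 1%:M by rewrite -[U^t*]mul1mx mulmxKtV.
rewrite !frob_trace trmx_mul map_mxM [LHS]mxtrace_mulC mulmxA -(mulmxA _ _ U) VV.
by rewrite mulmx1 mxtrace_mulC.
Qed.

Lemma frobN m n (X : 'M[R[i]]_(m, n)) : frob (- X) = frob X.
Proof.
apply: eq_bigr => i _; apply: eq_bigr => j _.
by rewrite mxE !sqr_normcE; case: (X i j) => x y /=; rewrite !sqrrN.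
Qed.

Lemma frob_parallelogram m n (X Y : 'M[R[i]]_(m, n)) :
  frob (X - Y) + frob (X + Y) = 2 * frob X + 2 * frob Y.
Proof.
rewrite /frob !mulr_sumr -!big_split; apply: eq_bigr => i _ /=.
rewrite !mulr_sumr -!big_split; apply: eq_bigr => j _ /=.
rewrite !mxE !sqr_normcE; case: (X i j) (Y i j) => [x x'] [y y'] /=.
ring.
Qed.

Definition projmx (Q : finType) (S : {set Q}) : 'M[R[i]]_#|Q| :=
  diag_mx (\row_i (enum_val i \in S)%:R).

Lemma projE (Q : finType) (S : {set Q}) (psi : l2 R Q) :
  proj S psi = projmx S *m psi.
Proof.
apply/matrixP => i j; rewrite (ord1 j) mul_diag_mx !mxE.
by case: ifP; rewrite ?mul1r ?mul0r.
Qed.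

Lemma frob_mul_proj (Q : finType) (S : {set Q}) m (M : 'M[R[i]]_(m, #|Q|)) :
  frob (M *m projmx S) <= frob M.
Proof.
apply: ler_sum => i _; apply: ler_sum => j _.
rewrite mul_mx_diag !mxE; case: (_ \in _); rewrite ?mulr1 ?mulr0 //.
by rewrite Normc.normc0 expr0n sqr_ge0.
Qed.

Lemma sqnormE (Q : finType) (psi : l2 R Q) : sqnorm psi = frob psi.
Proof. by apply: eq_bigr => i _; rewrite big_ord1. Qed.

Lemma sqnorm_ge0 (Q : finType) (psi : l2 R Q) : 0 <= sqnorm psi.
Proof. by rewrite sqnormE frob_ge0. Qed.

Lemma sqnorm_col_le (Q : finType) n (M : 'M[R[i]]_(#|Q|, n)) j :
  sqnorm (col j M : l2 R Q) <= frob M.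
Proof.
apply: ler_sum => i _; rewrite mxE (bigD1 j) //= lerDl.
by apply: sumr_ge0 => k _; exact: sqr_ge0.
Qed.

Lemma sqnorm_ket (Q : finType) (q : Q) : sqnorm (ket R q) = 1.
Proof.
rewrite /sqnorm (bigD1 (enum_rank q)) //= big1 => [|i /negPf ni].
  by rewrite mxE !eqxx addr0 Normc.normc1 expr1n.
by rewrite mxE ni Normc.normc0 expr0n.
Qed.

(** Coordinatewise, the gap between the two sides is [t^-1] times the squared modulus of
    [t * x - y]. This form of the triangle inequality avoids square roots. *)
Lemma sqnormD_le (Q : finType) (t : R) (x y : l2 R Q) : 0 < t ->
  sqnorm (x + y) <= (1 + t) * sqnorm x + (1 + t^-1) * sqnorm y.
Proof.
move=> t0; rewrite /sqnorm !mulr_sumr -big_split; apply: ler_sum => i _ /=.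
rewrite mxE !sqr_normcE; case: (x i 0) (y i 0) => [a b] [c d] /=.
rewrite -subr_ge0; set D := (X in 0 <= X).
have -> : D = t^-1 * ((t * a - c) ^+ 2 + (t * b - d) ^+ 2).
  by rewrite /D; field; rewrite gt_eqF.
by rewrite mulr_ge0 ?addr_ge0 ?sqr_ge0 // invr_ge0 ltW.
Qed.

Lemma sqnorm_proj_split (Q : finType) (S T : {set Q}) (psi : l2 R Q) :
  [disjoint S & T] ->
  sqnorm (proj S psi) + sqnorm (proj T psi) + sqnorm (proj (~: (S :|: T)) psi)
  = sqnorm psi.
Proof.
move=> dST; rewrite /sqnorm -!big_split; apply: eq_bigr => i _ /=.
have := disjointFr dST (x := enum_val i).
rewrite !mxE !inE !sqr_normcE; case: (_ \in S) => [/(_ isT) -> /=|_].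
  by rewrite expr0n !addr0.
by case: (_ \in T); rewrite /= expr0n /= ?addr0 ?add0r.
Qed.

End SquaredNorm.

(** * Bounds and continuity of halting probabilities *)

Section HaltingProbabilities.
Variables (R : realType) (Sigma : finType) (A : qfa R Sigma).
Implicit Types (psi : l2 R (state A)) (S : {set state A}) (w : seq (letter Sigma)).

Definition run psi w :=
  foldl (fun phi a => proj (non A) (trans A a *m phi) : l2 R (state A)) psi w.

Lemma halt_prob_cat S psi u w :
  halt_prob S psi (u ++ w) = halt_prob S psi u + halt_prob S (run psi u) w.
Proof.
elim: u psi => [|a u IH] psi /=; first by rewrite add0r.
by rewrite IH addrA.
Qed.

Lemma halt_prob_ge0 S psi w : 0 <= halt_prob S psi w.
Proof.
by elim: w psi => [|a w IH] psi //=; rewrite addr_ge0 ?sqnorm_ge0.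
Qed.

Lemma halt_prob_acc_rej_le psi w :
  halt_prob (acc A) psi w + halt_prob (rej A) psi w <= sqnorm psi.
Proof.
elim: w psi => [|a w IH] psi /=; first by rewrite addr0 sqnorm_ge0.
have -> : sqnorm psi = sqnorm (trans A a *m psi : l2 R (state A)).
  by rewrite !sqnormE frob_unitary_mul // trans_unitary.
rewrite -[leRHS](sqnorm_proj_split _ (acc_rej_disjoint A)) addrACA lerD2l.
exact: IH.
Qed.

(** A halting probability is a sum of squared norms of linear images of the superposition, so
    [sqnormD_le] applies to each term. *)
Lemma halt_probD_le S (t : R) psi phi w : 0 < t ->
  halt_prob S (psi + phi) w <=
  (1 + t) * halt_prob S psi w + (1 + t^-1) * halt_prob S phi w.
Proof.
move=> t0; elim: w psi phi => [|a w IH] psi phi /=; first by rewrite !mulr0 addr0.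
rewrite !mulrDr addrACA lerD //.
  by rewrite mulmxDr !projE mulmxDr sqnormD_le.
by rewrite mulmxDr !projE mulmxDr IH.
Qed.

Lemma sqnorm_run_le psi w : sqnorm (run psi w) <= sqnorm psi.
Proof.
elim: w psi => [|a w IH] psi //=; apply: le_trans (IH _) _.
have -> : sqnorm psi = sqnorm (trans A a *m psi : l2 R (state A)).
  by rewrite !sqnormE frob_unitary_mul // trans_unitary.
rewrite -[leRHS](sqnorm_proj_split _ (acc_rej_disjoint A)) lerDr.
by rewrite addr_ge0 ?sqnorm_ge0.
Qed.

Lemma accept_reject_le1 (w : seq Sigma) : accept_prob A w + reject_prob A w <= 1.
Proof. by rewrite -(sqnorm_ket R (start A)) halt_prob_acc_rej_le. Qed.

Lemma halt_prob_acc_le psi w : halt_prob (acc A) psi w <= sqnorm psi.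
Proof.
by apply: le_trans (halt_prob_acc_rej_le psi w); rewrite lerDl halt_prob_ge0.
Qed.

Lemma halt_prob_acc_near (t : R) (x y : l2 R (state A)) w :
  0 < t -> sqnorm y <= 1 ->
  halt_prob (acc A) x w <=
  halt_prob (acc A) y w + t + (1 + t^-1) * sqnorm (x - y).
Proof.
move=> t0 y1; rewrite -{1}[x](subrKC y).
apply: le_trans (halt_probD_le _ _ _ _ t0) _.
have t1 : 0 < 1 + t^-1 by rewrite addr_gt0 // invr_gt0.
rewrite lerD ?ler_pM2l // ?halt_prob_acc_le // mulrDl mul1r lerD2l.
by rewrite -[leRHS]mulr1 ler_pM2l // (le_trans (halt_prob_acc_le _ _)).
Qed.

End HaltingProbabilities.

(** * Pigeonhole and recurrence of contractions *)

Lemma nat_pigeonhole (T : finType) (g : nat -> T) :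
  exists k l, (k < l)%N /\ g k = g l.
Proof.
pose h (i : 'I_#|T|.+1) := g i.
have /injectivePn [i [j ij hij]] : ~~ injectiveb h.
  by apply/negP => /injectiveP /leq_card; rewrite card_ord ltnn.
have : (i < j)%N || (j < i)%N by rewrite -neq_ltn.
by case/orP => lt; [exists i, j | exists j, i].
Qed.

Section Recurrence.
Variable R : realType.

(** Cut [[-C, C]] into finitely many cells of width [e]; two indices share the cell of every
    coordinate. *)
Lemma bounded_pigeonhole (I : finType) (f : nat -> I -> R) (C e : R) :
  0 < e -> (forall k i, `|f k i| <= C) ->
  exists k l, (k < l)%N /\ forall i, `|f k i - f l i| <= e.
Proof.
move=> e0 fC.
pose K := Num.truncn ((C + C) / e).
pose g k := [ffun i => inord (Num.truncn ((f k i + C) / e)) : 'I_K.+1].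
have [k [l [kl gkl]]] := nat_pigeonhole g.
exists k, l; split=> // i.
have ge0 j : 0 <= (f j i + C) / e.
  by rewrite divr_ge0 ?(ltW e0) //; have := fC j i; rewrite ler_norml; lra.
have leK j : (Num.truncn ((f j i + C) / e) < K.+1)%N.
  rewrite ltnS le_truncn // ler_pM2r ?invr_gt0 // lerD2r.
  by have := fC j i; rewrite ler_norml => /andP[].
move/ffunP/(_ i): gkl; rewrite !ffunE => /(congr1 (@nat_of_ord _)).
rewrite !inordK // => eqt.
have := truncn_itv (ge0 k); have := truncn_itv (ge0 l); rewrite eqt -addn1 natrD.
rewrite !ler_pdivlMr // !ltr_pdivrMr // ler_norml.
by move: (Num.truncn _)%:R => c; rewrite !mulrDl mul1r; lra.
Qed.

Lemma frob_pigeonhole m n (F : nat -> 'M[R[i]]_(m, n)) (C e : R) :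
  0 < e -> (forall k, frob (F k) <= C) ->
  exists k l, (k < l)%N /\ frob (F k - F l) <= e.
Proof.
move=> e0 FC.
have entry_le k i j : complex.Re (F k i j) ^+ 2 + complex.Im (F k i j) ^+ 2 <= C.
  apply: le_trans (FC k); rewrite -sqr_normcE /frob (bigD1 i) //= (bigD1 j) //=.
  by rewrite -addrA lerDl addr_ge0 // !sumr_ge0 // => *;
    rewrite ?sumr_ge0 // => *; exact: sqr_ge0.
have C0 : 0 <= C by apply: le_trans (FC 0%N); exact: frob_ge0.
pose f k (x : bool * ('I_m * 'I_n)) : R :=
  let z := F k x.2.1 x.2.2 in if x.1 then complex.Re z else complex.Im z.
pose N : R := (m * n)%:R.
(* Since [d <= 1], real and imaginary parts within [d] give at most [2 * d] per entry, and
   [2 * N * d <= e]. *)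
pose d : R := e / (2 * N + 1 + e).
have N0 : 0 <= N by exact: ler0n.
have d0 : 0 < d by rewrite divr_gt0 //; lra.
have d1 : d <= 1 by rewrite ler_pdivrMr; lra.
have fC k x : `|f k x| <= C + 1.
  have := entry_le k x.2.1 x.2.2; rewrite /f.
  move: (complex.Re _) (complex.Im _) => u v uv.
  have := sqr_ge0 (u - 1); have := sqr_ge0 (u + 1).
  have := sqr_ge0 (v - 1); have := sqr_ge0 (v + 1).
  have := sqr_ge0 u; have := sqr_ge0 v.
  by case: x.1; rewrite ler_norml; nra.
have [k [l [kl near]]] := bounded_pigeonhole d0 fC.
exists k, l; split=> //.
have -> : e = (2 * N + 1 + e) * d by rewrite mulrC divfK //; lra.
apply: (@le_trans _ _ (\sum_(i < m) \sum_(j < n) 2 * d)).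
  apply: ler_sum => i _; apply: ler_sum => j _.
  have := near (true, (i, j)); have := near (false, (i, j)).
  rewrite /f /= sqr_normcE !mxE.
  case: (F k i j) (F l i j) => [a b] [c c'] /=; rewrite !ler_norml.
  by move: d0 d1; nra.
rewrite sumr_const sumr_const !card_ord -mulrnA mulnC -mulr_natl -/N.
by nra.
Qed.

Lemma frobB_le m n (X Y : 'M[R[i]]_(m, n)) :
  frob (X - Y) <= 2 * frob X + 2 * frob Y.
Proof. by have := frob_parallelogram X Y; have := frob_ge0 (X + Y); lra. Qed.

(* The loss [frob X - frob (X *m T)] obeys the parallelogram law and is
   nonnegative, so a difference of two matrices with small loss has small loss;
   this is what allows [T ^+ k] to be cancelled from [M *m T ^+ k]. *)
Lemma contraction_recurrence m n (M : 'M[R[i]]_(m, n)) (T : 'M[R[i]]_n) (e : R) :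
  0 < e -> (forall X : 'M[R[i]]_(m, n), frob (X *m T) <= frob X) ->
  (forall k, frob M <= frob (M *m T ^+ k) + e) ->
  exists2 j, (0 < j)%N & frob (M - M *m T ^+ j) <= 5 * e.
Proof.
move=> e0 contr lossM.
have contrX k (X : 'M[R[i]]_(m, n)) : frob (X *m T ^+ k) <= frob X.
  elim: k => [|k IH]; first by rewrite expr0 mulmx1.
  by rewrite exprSr -mulmxE mulmxA (le_trans (contr _)).
have MX k l : M *m T ^+ k *m T ^+ l = M *m T ^+ (k + l).
  by rewrite -mulmxA mulmxE -exprD.
have [k [l [kl near]]] :=
  @frob_pigeonhole _ _ (fun k => M *m T ^+ k) _ _ e0 (fun k => contrX k M).
exists (l - k)%N; first by rewrite subn_gt0.
have Y := frob_parallelogram M (M *m T ^+ (l - k)).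
have YT := frob_parallelogram (M *m T ^+ k) (M *m T ^+ (l - k) *m T ^+ k).
rewrite -mulmxBl -mulmxDl in YT.
have S := contrX k (M + M *m T ^+ (l - k)).
have Z : frob ((M - M *m T ^+ (l - k)) *m T ^+ k) <= e.
  by rewrite mulmxBl MX subnK // ltnW.
(* The difference loses at most [2 * e + 2 * e] under [T ^+ k], and at most [e] is left by [Z];
   hence [5 * e]. *)
have L1 := lossM k; have L2 := lossM l; have L3 := contrX (l - k)%N M.
rewrite MX subnK in YT; last exact: ltnW.
lra.
Qed.

End Recurrence.

(** * Words that the automaton can hardly distinguish *)

Section NearMinimalWords.
Variables (R : realType) (Sigma : finType) (A : qfa R Sigma).
Implicit Types (w : seq (letter Sigma)).

(** Later letters stand on the left, so multiplying on the right prepends a word. *)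
Definition word_mx w : 'M[R[i]]_#|state A| :=
  foldl (fun M a => projmx R (non A) *m trans A a *m M) 1%:M w.

Lemma word_mx_cat u w : word_mx (u ++ w) = word_mx w *m word_mx u.
Proof.
rewrite /word_mx foldl_cat; elim/last_ind: w => [|w a IH]; first by rewrite mul1mx.
by rewrite !foldl_rcons IH !mulmxA.
Qed.

Lemma word_mx_nseq k a : word_mx (nseq k a) = word_mx [:: a] ^+ k.
Proof.
elim: k => [|k IH] //; rewrite -[nseq k.+1 a]/([:: a] ++ nseq k a).
by rewrite word_mx_cat IH exprSr.
Qed.

Lemma runE psi w : run psi w = word_mx w *m psi.
Proof.
rewrite /run /word_mx; elim/last_ind: w => [|w a IH]; first by rewrite mul1mx.
by rewrite !foldl_rcons IH projE !mulmxA.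
Qed.

Lemma frob_mul_word_mx_le m (X : 'M[R[i]]_(m, #|state A|)) w :
  frob (X *m word_mx w) <= frob X.
Proof.
elim/last_ind: w => [|w a IH] in X *; first by rewrite mulmx1.
rewrite -cats1 word_mx_cat mulmxA; apply: le_trans (IH _) _.
rewrite /word_mx /= mulmx1 mulmxA frob_mul_unitary ?trans_unitary //.
exact: frob_mul_proj.
Qed.

(** The product is the evolution along [v ++ u], again a word over [Sigma], so its norm is at least
    the infimum that [u] nearly attains. *)
Lemma near_minimal_word (e : R) : 0 < e ->
  exists u : seq Sigma, forall v : seq Sigma,
  frob (word_mx (map (@Sym _) u)) <=
  frob (word_mx (map (@Sym _) u) *m word_mx (map (@Sym _) v)) + e.
Proof.
move=> e0.
pose E : set R :=
  [set x | exists u : seq Sigma, x = frob (word_mx (map (@Sym _) u))]%classic.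
have lbE : lbound E 0 by move=> _ [u ->]; exact: frob_ge0.
have infE : has_inf E.
  by split; [exists (frob (word_mx (map (@Sym _) [::]))), [::] | exists 0].
have [_ [u ->] lt_u] := inf_adherent e0 infE.
exists u => v; rewrite -word_mx_cat -map_cat.
apply: le_trans (ltW lt_u) _; rewrite lerD2r.
by apply: ge_inf; [exact: infE.2 | exists (v ++ u)].
Qed.

Lemma indistinguishable_words (a b : Sigma) (e : R) : 0 < e ->
  exists (u : seq Sigma) (m n : nat),
  let x := run (ket R (start A)) (LeftEnd :: map (@Sym _) (b :: u)) in
  let y := run (ket R (start A))
    (LeftEnd :: map (@Sym _) (a :: nseq m.+1 b ++ nseq n.*2.+1 a ++ b :: u)) in
  sqnorm (x - y : l2 R (state A)) <= e.
Proof.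
(* Two recurrences, each with error [5 * (e / 20)], are combined by [frobB_le], which doubles
   both. *)
move=> e0; have e20 : 0 < e / 20 by rewrite divr_gt0.
have [u min_u] := near_minimal_word e20.
pose Oa := word_mx [:: Sym a]; pose Ob := word_mx [:: Sym b].
pose M := word_mx (map (@Sym _) (b :: u)).
have ME : M = word_mx (map (@Sym _) u) *m Ob by rewrite /M -word_mx_cat.
have loss v : frob M <= frob (M *m word_mx (map (@Sym _) v)) + e / 20.
  rewrite ME (le_trans (frob_mul_word_mx_le _ _)) // -mulmxA -word_mx_cat.
  by have := min_u (v ++ [:: b]); rewrite map_cat.
have [k k0 Hk] : exists2 k, (0 < k)%N &
    frob (M - M *m word_mx (map (@Sym _) [:: a; a]) ^+ k) <= 5 * (e / 20).
  apply: contraction_recurrence => // [X|k]; first exact: frob_mul_word_mx_le.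
  have := loss (flatten (nseq k [:: a; a])).
  suff -> : word_mx (map (@Sym _) (flatten (nseq k [:: a; a]))) =
      word_mx (map (@Sym _) [:: a; a]) ^+ k by [].
  elim: k => [|k IH] //; rewrite [nseq _ _]/= [flatten _]/=.
  by rewrite -[_ :: _]/([:: a; a] ++ _) map_cat word_mx_cat IH exprSr.
(* Of the [2 * k] letters [a] that may be prepended, one is kept aside: [b^j] is inserted between it
   and the other [2 * k - 1]. *)
have [j j0 Hj] : exists2 j, (0 < j)%N &
    frob (M *m Oa ^+ k.-1.*2.+1
          - M *m Oa ^+ k.-1.*2.+1 *m Ob ^+ j) <= 5 * (e / 20).
  apply: contraction_recurrence => // [X|j]; first exact: frob_mul_word_mx_le.
  rewrite -!word_mx_nseq (le_trans (frob_mul_word_mx_le _ _)) // -mulmxA -word_mx_cat.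
  by have := loss (nseq j b ++ nseq k.-1.*2.+1 a); rewrite map_cat !map_nseq.
exists u, j.-1, k.-1 => x y.
pose Z : 'M_#|state A| := M - M *m Oa ^+ k.-1.*2.+1 *m Ob ^+ j *m Oa.
have xyE : x - y = col (enum_rank (start A)) (Z *m word_mx [:: LeftEnd]).
  rewrite colE /x /y !runE (prednK j0).
  rewrite -(cat1s a (nseq _ _ ++ _)) -(cat1s LeftEnd (map _ (b :: u))).
  rewrite -(cat1s LeftEnd (map _ (_ ++ _))) word_mx_cat.
  rewrite 3!map_cat 2!map_nseq 4!word_mx_cat.
  rewrite (word_mx_nseq _ (Sym a)) (word_mx_nseq _ (Sym b)).
  rewrite -/M -[word_mx (map _ [:: a])]/Oa -/Oa -/Ob /Z.
  rewrite -[delta_mx _ 0]/(ket R (start A)).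
  move: (word_mx [:: LeftEnd]) => L; clearbody M Oa Ob.
  by rewrite 2!mulmxBl.
rewrite xyE; apply: le_trans (sqnorm_col_le _ _) _.
apply: le_trans (frob_mul_word_mx_le _ _) _.
have lossa := frob_mul_word_mx_le
  (M *m Oa ^+ k.-1.*2.+1 *m Ob ^+ j - M *m Oa ^+ k.-1.*2.+1) [:: Sym a].
rewrite (word_mx_nseq 2 (Sym a) : word_mx (map _ [:: a; a]) = _) -/Oa in Hk.
rewrite -/Oa in lossa; rewrite /Z; clearbody M Oa Ob.
(* The comparison passes through the evolution along [a^(2k) b u]. *)
have -> : M - M *m Oa ^+ k.-1.*2.+1 *m Ob ^+ j *m Oa = (M - M *m (Oa ^+ 2) ^+ k)
    - (M *m Oa ^+ k.-1.*2.+1 *m Ob ^+ j - M *m Oa ^+ k.-1.*2.+1) *m Oa.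
  rewrite mulmxBl -(mulmxA M (Oa ^+ _) Oa) mulmxE -exprSr -exprM.
  have -> : (2 * k = k.-1.*2.+2)%N by lia.
  by rewrite opprB addrA subrK.
apply: le_trans (frobB_le _ _) _; rewrite -opprB in Hj.
rewrite frobN in Hj; lra.
Qed.

Lemma accept_prob_cat (u s : seq Sigma) :
  accept_prob A (u ++ s) =
  halt_prob (acc A) (ket R (start A)) (LeftEnd :: map (@Sym _) u) +
  halt_prob (acc A) (run (ket R (start A)) (LeftEnd :: map (@Sym _) u))
    (rcons (map (@Sym _) s) RightEnd).
Proof.
by rewrite /accept_prob /endmarked map_cat rcons_cat -cat_cons halt_prob_cat.
Qed.

(** The probability accepted while reading [v] or [w] occurs on both sides and cancels; the
    remainders start from nearby superpositions. *)
Lemma accept_prob_exchange (a b : Sigma) (d : R) : 0 < d ->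
  exists (u : seq Sigma) (m n : nat),
  let v := b :: u in
  let w := a :: nseq m.+1 b ++ nseq n.*2.+1 a ++ b :: u in
  forall s t,
  accept_prob A (v ++ s) + accept_prob A (w ++ t) <=
  accept_prob A (v ++ t) + accept_prob A (w ++ s) + d.
Proof.
(* Each of the two replacements of a superposition costs [t + t]. *)
move=> d0; pose t := d / 4; have t0 : 0 < t by rewrite divr_gt0.
have t1 : 0 < 1 + t^-1 by rewrite addr_gt0 ?invr_gt0.
have [u [m [n near]]] := indistinguishable_words a b (divr_gt0 t0 t1).
exists u, m, n => v w s s'.
move: near; lazy zeta; rewrite -/v -/w !accept_prob_cat.
have run1 z : sqnorm (run (ket R (start A)) z) <= 1.
  by rewrite -(sqnorm_ket R (start A)) sqnorm_run_le.
set x := run _ (_ :: map _ v); set y := run _ (_ :: map _ w) => near.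
have near' : (1 + t^-1) * sqnorm (x - y : l2 R (state A)) <= t.
  by rewrite mulrC -ler_pdivlMr.
have near'' : (1 + t^-1) * sqnorm (y - x : l2 R (state A)) <= t.
  by rewrite sqnormE -opprB frobN -sqnormE.
have := halt_prob_acc_near x (rcons (map (@Sym _) s) RightEnd) t0
  (run1 (LeftEnd :: map (@Sym _) w)).
have := halt_prob_acc_near y (rcons (map (@Sym _) s') RightEnd) t0
  (run1 (LeftEnd :: map (@Sym _) v)).
rewrite -/x -/y; move: near' near''; rewrite /t; lra.
Qed.

End NearMinimalWords.

(** * The language [K] and its non-recognizability *)

Definition odd_after (w : seq bool) : bool :=
  (false \in w) && odd (count_mem true (drop (index false w) w)).

Lemma odd_after_not_recognizable (R : realType) :
  ~ qfa_recognizable R [set w : seq bool | odd_after w]%classic.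
Proof.
move=> [A [p [p_gt [accL rejL]]]].
have acc_le w : ~~ odd_after w -> accept_prob A w <= 1 - p.
  by move=> /negP /rejL; have := accept_reject_le1 A w; lra.
(* With this error the exchange inequality yields [2 * p <= 2 * (1 - p) + (2 * p - 1) = 1], against
   [2^-1 < p]. *)
have [|u [m [n]]] := @accept_prob_exchange R bool A true false (2 * p - 1).
  by lra.
set v := false :: u; set w := true :: _; lazy zeta => H.
have count_u : odd_after v = odd (count_mem true u) by rewrite /odd_after in_cons.
(* The leading [a] precedes the first [b], and the [2 * n + 1] letters [a] after it flip the
   parity. *)
have count_w : odd_after w = ~~ odd (count_mem true u).
  rewrite /odd_after /w /= !(count_cat, count_nseq) /= !(count_cat, count_nseq) /=.
  by rewrite mul1n !add0n oddD odd_double.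
have odd1 x : false \in x -> odd_after (x ++ [:: true]) = ~~ odd_after x.
  move=> fx; rewrite /odd_after mem_cat fx /= index_cat fx drop_cat index_mem fx.
  by rewrite count_cat /= oddD addbT.
have fv : false \in v by rewrite in_cons.
have fw : false \in w by rewrite !in_cons.
have := odd1 _ fv; have := odd1 _ fw; rewrite count_u count_w.
case: (odd _) count_u count_w => /= v1 w1 w2 v2.
  have := accL _ v1; have := accL _ w2.
  have := acc_le _ (negbT w1); have := acc_le _ (negbT v2).
  by have := H [::] [:: true]; rewrite !cats0; lra.
have := accL _ v2; have := accL _ w1.
have := acc_le _ (negbT w2); have := acc_le _ (negbT v1).
by have := H [:: true] [::]; rewrite !cats0; lra.
Qed.

(** * Vectors and matrices with real entries, indexed by states *)

Section RealAmplitudes.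
Variables (R : realType) (Q : finType).
Implicit Types (f : Q -> R) (k : Q -> Q -> R).

Definition vec f : l2 R Q := \col_i (f (enum_val i))%:C%C.

Definition kernel_mx k : 'M[R[i]]_#|Q| :=
  \matrix_(i, j) (k (enum_val i) (enum_val j))%:C%C.

Lemma sum_enum_val (V : nmodType) (F : Q -> V) :
  \sum_(i < #|Q|) F (enum_val i) = \sum_q F q.
Proof.
rewrite (reindex (@enum_rank Q)); last exact: onW_bij (@enum_rank_bij Q).
by apply: eq_bigr => q _; rewrite enum_rankK.
Qed.

Lemma eq_vec f g : f =1 g -> vec f = vec g.
Proof. by move=> fg; apply/matrixP => i j; rewrite !mxE fg. Qed.

Lemma vec_ket (q : Q) : ket R q = vec (fun r => (r == q)%:R).
Proof.
apply/matrixP => i j; rewrite !mxE (ord1 j) andbT rmorph_nat.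
by rewrite -(inj_eq enum_val_inj) enum_rankK.
Qed.

Lemma kernel_mx_mul k f : kernel_mx k *m vec f = vec (fun q => \sum_r k q r * f r).
Proof.
apply/matrixP => i j; rewrite !mxE -sum_enum_val rmorph_sum.
by apply: eq_bigr => l _; rewrite !mxE rmorphM.
Qed.

Lemma proj_vec (S : {set Q}) f : proj S (vec f) = vec (fun q => (q \in S)%:R * f q).
Proof.
apply/matrixP => i j; rewrite !mxE.
by case: ifP => _; rewrite ?mul1r ?mul0r.
Qed.

Lemma sqnorm_vec f : sqnorm (vec f) = \sum_q f q ^+ 2.
Proof.
rewrite -sum_enum_val; apply: eq_bigr => i _.
by rewrite mxE sqr_normcE /= expr0n addr0.
Qed.

Lemma kernel_mx_unitary k :
  (forall q q', \sum_r k q r * k q' r = (q == q')%:R) ->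
  kernel_mx k \is unitarymx.
Proof.
move=> kk; apply/unitarymxP/matrixP => i j; rewrite !mxE.
rewrite -(inj_eq enum_val_inj) -(rmorph_nat (real_complex R)) -kk.
rewrite -sum_enum_val rmorph_sum.
apply: eq_bigr => l _; rewrite !mxE rmorphM; congr (_ * _).
by apply: conj_Creal; apply/complex_realP; eexists.
Qed.

End RealAmplitudes.

(** * The automaton for one half of [K] *)

Section Automaton.
Variables (R : realType) (c : bool).

Definition states : finType := (bool * bool * bool)%type.

(* A state is [(h, k, x)]: [h] tells whether it is halting, [k] selects the first
   ([false]) or second ([true]) automaton, and [x] is the tracked parity.  On [b]
   the second automaton moves to the halting states of the first one, with the
   answer bit complemented so that a single halting state [(true, false, ~~ c)]
   is accepting for both. *)
Definition letter_perm (l : letter bool) (q : states) : states :=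
  let: (h, k, x) := q in
  match l with
  | LeftEnd => q
  | Sym true => (h, k, if h then x else ~~ x)
  | Sym false => if h == k then q else (k, h, ~~ x)
  | RightEnd => (~~ h, k, x)
  end.

Lemma letter_permK l : involutive (letter_perm l).
Proof. by case: l => [|[]|] [[[] []] []]. Qed.

(* The left endmarker acts as the reflection along this vector of squared norm 3,
   which sends the start state to a superposition of itself,
   [(false, false, false)] and [(false, true, false)] with amplitudes 1/3, 2/3
   and 2/3. *)
Definition axis (q : states) : R :=
  let: (h, k, x) := q in
  if x then 0 else if h then (if k then 1 else 0) else -1.

(** As [letter_perm l] is an involution, its matrix is symmetric, and the order of [q] and [r] does
    not affect which state is sent where. *)
Definition amplitude (l : letter bool) (q r : states) : R :=
  if l is LeftEnd then (q == r)%:R - 2 / 3 * axis q * axis r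
  else (letter_perm l q == r)%:R.

Lemma sum_states (F : states -> R) :
  \sum_q F q = F (true, true, true) + F (true, true, false)
    + F (true, false, true) + F (true, false, false)
    + F (false, true, true) + F (false, true, false)
    + F (false, false, true) + F (false, false, false).
Proof.
have -> : \sum_q F q = \sum_(h : bool) \sum_(k : bool) \sum_(x : bool) F (h, k, x).
  rewrite pair_bigA pair_bigA; apply: eq_bigr => -[[h k] x] _ //.
by rewrite !big_bool /= !addrA.
Qed.

Lemma sum_delta (q : states) (f : states -> R) : \sum_r (q == r)%:R * f r = f q.
Proof.
rewrite (bigD1 q) //= eqxx mul1r big1 ?addr0 // => r.
by rewrite eq_sym => /negPf ->; rewrite mul0r.
Qed.

Lemma amplitude_unitary l : kernel_mx (amplitude l) \is unitarymx.
Proof.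
apply: kernel_mx_unitary => q q'.
have perm : l <> LeftEnd -> \sum_r amplitude l q r * amplitude l q' r = (q == q')%:R.
  by case: l => [//|a|] _ /=;
    rewrite sum_delta (inj_eq (inv_inj (letter_permK _))) eq_sym.
case: l perm => [_|a ->|->] //=.
rewrite sum_states.
by case: q q' => [[[] []] []] [[[] []] []]; rewrite /axis !xpair_eqE /=; field.
Qed.

(** Here [c] is the required parity of the [a]s before the first [b]. An odd number after it makes
    the total parity [~~ c], the bit left by the first automaton; the second leaves the complement
    of [c]. *)
Definition acc_states : {set states} := [set (true, false, ~~ c)].

Definition rej_states : {set states} :=
  [set q : states | q.1.1 && (q != (true, false, ~~ c))].

Lemma acc_rej_states_disjoint : [disjoint acc_states & rej_states].
Proof.
rewrite finset.disjoints_subset; apply/fintype.subsetP => q.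
by rewrite !inE negb_and negbK => ->; rewrite orbT.
Qed.

Definition automaton : qfa R bool :=
  @QFA R bool states (fun l => kernel_mx (amplitude l)) (true, true, false)
    acc_states rej_states amplitude_unitary acc_rej_states_disjoint.

Lemma non_automaton (q : states) : (q \in non automaton) = ~~ q.1.1.
Proof.
rewrite !inE /=; case: eqP => [->|_] //=.
by rewrite andbT.
Qed.

(** The amplitude [d] of the second automaton is 2/3 until it halts and 0 afterwards. *)
Definition superposition (x y : bool) (d : R) (q : states) : R :=
  let: (h, k, z) := q in
  if h then 0 else if k then (z == y)%:R * d else (z == x)%:R * (2 / 3).

Section Halting.
Variable (S : {set states}).
Hypothesis haltS : forall q, q \in S -> q.1.1.

Lemma halt_prob_step l f w :
  let g q := \sum_r amplitude l q r * f r in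
  @halt_prob R bool automaton S (vec f) (l :: w) =
  \sum_q (q \in S)%:R * g q ^+ 2 +
  @halt_prob R bool automaton S (vec (fun q => (~~ q.1.1)%:R * g q)) w.
Proof.
rewrite /= kernel_mx_mul !proj_vec sqnorm_vec; congr (_ + _).
  by apply: eq_bigr => q _; case: (_ \in S); rewrite ?mul1r // !mul0r expr0n.
by congr (halt_prob _ _ _); apply: eq_vec => q; rewrite non_automaton.
Qed.

Let notinS k x : ((false, k, x) : states) \in S = false.
Proof. by apply/negP => /haltS. Qed.

Lemma halt_prob_superposition w x y d :
  @halt_prob R bool automaton S (vec (superposition x y d))
    (rcons (map (@Sym _) w) RightEnd) =
  4 / 9 * ((true, false, x (+) odd (count_mem true w)) \in S)%:R +
  d ^+ 2 * ((if false \in w then (true, false, ~~ (y (+) odd (index false w)))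
             else (true, true, y (+) odd (size w))) \in S)%:R.
Proof.
elim: w x y d => [|[] w IH] x y d; rewrite halt_prob_step.
- rewrite sum_states /= addr0 !sum_delta /= !notinS !addbF.
  by case: x y => [] []; rewrite /=; field.
- rewrite sum_states !sum_delta /= !notinS.
  rewrite (_ : vec _ = vec (superposition (~~ x) (~~ y) d)).
    rewrite IH /= in_cons add0n !addNb !addbN expr0n /=; by field.
  apply: (@eq_vec R states) => -[[[] k] z]; rewrite sum_delta /= ?mul0r ?mul1r //.
  by case: x y k z => [] [] [] [].
rewrite sum_states !sum_delta /= !notinS.
(* On [b] the whole weight of the second automaton halts, while the first is unchanged. *)
rewrite (_ : vec _ = vec (superposition x y 0)).
  rewrite IH expr0n /= mul0r addr0 add0n addbF.
  by case: y; rewrite /=; field.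
apply: (@eq_vec R states) => -[[[] []] z]; rewrite sum_delta /= ?mul0r ?mul1r ?mulr0 //.
Qed.

Lemma halt_prob_automaton w :
  @halt_prob R bool automaton S (ket R (start automaton)) (endmarked w) =
  9^-1 * ((true, true, false) \in S)%:R +
  4 / 9 * ((true, false, odd (count_mem true w)) \in S)%:R +
  4 / 9 * ((if false \in w then (true, false, ~~ odd (index false w))
             else (true, true, odd (size w))) \in S)%:R.
Proof.
pose q0 : states := (true, true, false).
rewrite vec_ket halt_prob_step -[start automaton]/q0.
have kappa q : \sum_r amplitude LeftEnd q r * (r == q0)%:R =
    superposition false false (2 / 3) q + (q == q0)%:R / 3.
  rewrite sum_states /q0 /=.
  by case: q => [[[] []] []]; rewrite ?xpair_eqE /=; field.
rewrite (_ : vec _ = vec (superposition false false (2 / 3))); last first.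
  apply: (@eq_vec R states) => q; rewrite kappa.
  by case: q => [[[] k] z]; rewrite /= ?mul0r // ?xpair_eqE /=; field.
rewrite halt_prob_superposition sum_states !kappa !notinS ?xpair_eqE /=.
by field.
Qed.

End Halting.

Definition odd_after_start (w : seq bool) : bool :=
  odd_after w && (odd (index false w) == c).

(** Only [a]s precede the first [b], so its index counts them. *)
Lemma count_true w : false \in w ->
  count_mem true w = (index false w + count_mem true (drop (index false w) w))%N.
Proof. by elim: w => [//|[] w IH] //= wf; rewrite IH. Qed.

Lemma odd_after_start_recognizable :
  qfa_recognizable R [set w : seq bool | odd_after_start w]%classic.
Proof.
exists automaton, (5 / 9); split; first by lra.
split=> w; rewrite /= /odd_after_start /odd_after.
  move=> /andP[/andP[wf ow] /eqP ic]; rewrite /accept_prob halt_prob_automaton.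
    rewrite wf (count_true wf) oddD ow ic addbT !inE !eqxx /=; lra.
  by move=> q; rewrite inE => /eqP ->.
move=> /negP nw; rewrite /reject_prob halt_prob_automaton; last first.
  by move=> q; rewrite inE => /andP[].
rewrite !inE ?xpair_eqE /=.
case: (boolP (false \in w)) nw => [wf|_] /=.
  rewrite (count_true wf) oddD.
  by case: (odd (index _ _)); case: (odd (count_mem _ _)); case: c => //= _; lra.
(* Without a [b], the second automaton ends in a state [(true, true, _)], which rejects: 4/9 + 1/9
   regardless of the first. *)
rewrite ?xpair_eqE /= => _.
by case: (_ == _) => /=; lra.
Qed.

End Automaton.

(** * The two halves and their union *)

Local Open Scope classical_set_scope.

Theorem corollary3p1 (R : realType) :
  exists (Sigma : finType) (L L' : set (seq Sigma)),
    qfa_recognizable R L /\ qfa_recognizable R L' /\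
    ~ qfa_recognizable R (L `|` L').
Proof.
exists bool, [set w | odd_after_start true w], [set w | odd_after_start false w].
split; first exact: odd_after_start_recognizable.
split; first exact: odd_after_start_recognizable.
have -> : [set w | odd_after_start true w] `|` [set w | odd_after_start false w] =
    [set w : seq bool | odd_after w].
  apply/seteqP; split=> w; rewrite /= /odd_after_start.
    by case=> /andP[].
  by move=> ->; case: (odd (index _ _)); [left | right].
exact: odd_after_not_recognizable.
Qed.
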